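(* Let $(X,\tau)$ be an uncountable Polish space and $1\le\xi<\omega_1$. Then $\delta_{fin}(f)\approx\alpha_\xi(f)$ for every bounded Baire class $\xi$ function $f:X\to\mathbb{R}$.
   Context: For countable ordinals, $\theta\lesssim\theta'$ means: for every $1\le\eta<\omega_1$, $\theta'\le\omega^\eta$ implies $\theta\le\omega^\eta$; $\theta\approx\theta'$ means both directions hold. A decreasing sequence $(F_\eta)_{\eta<\lambda}$ of subsets of $X$ is continuous if $F_0=X$, $F_\eta=\bigcap_{\theta<\eta}F_\theta$ for limit $\eta<\lambda$, and $\bigcap_{\eta<\lambda}F_\eta=\emptyset$ if $\lambda$ is a limit; $F_\eta=\emptyset$ for $\eta\ge\lambda$. Its transfinite difference is $\bigcup_{\eta<\lambda,\ \eta\text{ even}}(F_\eta\setminus F_{\eta+1})$. For disjoint $\boldsymbol\Pi^0_{\xi+1}$ sets $A,B$, $\alpha_\xi(A,B)$ is the least $\lambda$ for which some continuous decreasing sequence $(F_\eta)_{\eta<\lambda}$ of $\boldsymbol\Pi^0_\xi$ sets has transfinite difference $H$ with $A\subseteq H\subseteq X\setminus B$; $\alpha_\xi(f)=\sup\{\alpha_\xi(\{f\le p\},\{f\ge q\}):p<q\text{ rational}\}$. The finite partition rank of a bounded Baire class $\xi$ function is $\delta_{fin}(f)=\sup_{\varepsilon>0}\min\{\max_{n\le N}\alpha_\xi(H_n,X\setminus H_n): N\in\omega$, $H_0,\dots,H_N$ pairwise disjoint $\boldsymbol\Delta^0_{\xi+1}$ sets covering $X$, and there are reals $c_0,\dots,c_N$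 with $|f-\sum_{n\le N}c_n\chi_{H_n}|\le\varepsilon$ everywhere$\}$. *)

(* Defs.v *)
From HB Require Import structures.
From mathcomp Require Import all_boot all_order all_algebra.
From mathcomp Require Import all_classical all_reals all_analysis.

Set Implicit Arguments.
Unset Strict Implicit.
Unset Printing Implicit Defensive.

Import Order.TTheory GRing.Theory Num.Theory.
Import numFieldNormedType.Exports.

Local Open Scope classical_set_scope.
Local Open Scope ring_scope.
Local Open Scope order_scope.

(** Fix a well-order of the (uncountable) type [set nat]. The points with
    countably many predecessors form an initial segment of order type omega_1:
    a well-order that is uncountable ([omega1_uncountable]) and all of whose
    proper initial segments are countable ([omega1_seg_countable]). Its elements
    are therefore the countable ordinals, each exactly once. *)

Definition set_nat_le : rel (set nat) :=
  sval (wochoice.well_ordering_principle (set nat)).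

Lemma set_nat_wo : wochoice.well_order set_nat_le.
Proof. exact: (svalP (wochoice.well_ordering_principle (set nat))). Qed.

Lemma set_nat_wo_chain : wochoice.wo_chain set_nat_le {: set nat}.
Proof. by move=> A _; exact: set_nat_wo. Qed.

Lemma set_nat_lexx : reflexive set_nat_le.
Proof. by move=> x; exact: (wochoice.wo_chain_reflexive set_nat_wo_chain). Qed.

Lemma set_nat_le_total : total set_nat_le.
Proof. by move=> x y; exact: (wochoice.wo_chainW set_nat_wo_chain). Qed.

Lemma set_nat_le_anti : antisymmetric set_nat_le.
Proof.
by move=> x y; exact: (wochoice.wo_chain_antisymmetric set_nat_wo_chain).
Qed.

Lemma set_nat_least (A : set (set nat)) : A !=set0 ->
  exists2 x, A x & forall y, A y -> set_nat_le x y.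
Proof.
case=> x0 Ax0; have [|x [[Ax minx] _]] := @set_nat_wo (mem A).
  by exists x0; rewrite inE.
exists x; first by move: Ax; rewrite inE.
by move=> y Ay; apply: minx; rewrite inE.
Qed.

Lemma set_nat_le_trans : transitive set_nat_le.
Proof.
move=> y x z xy yz.
have [|w] := @set_nat_least [set x; y; z]; first by exists x; left; left.
case=> [[->|->]|->] minw.
- by apply: minw; right.
- have yx : set_nat_le y x by apply: minw; left; left.
  by have -> : x = y by apply: set_nat_le_anti; rewrite xy yx.
- have zy : set_nat_le z y by apply: minw; left; right.
  by have <- : y = z by apply: set_nat_le_anti; rewrite zy yz.
Qed.

Lemma set_nat_uncountable : ~ countable [set: set nat].
Proof.
move/countable_injP => [g ginj].
pose D := [set n | exists A : set nat, g A = n /\ ~ A n].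
have [DgD|nDgD] := pselect (D (g D)).
- have [A [gA nA]] := DgD.
  by move: nA; rewrite (ginj A D (mem_set I) (mem_set I) gA).
- by apply: (nDgD); exists D.
Qed.

Definition in_omega1 (x : set nat) : bool :=
  `[< countable [set y | set_nat_le y x] >].

Definition omega1 := {x : set nat | in_omega1 x}.

HB.instance Definition _ := Choice.copy omega1 {x : set nat | in_omega1 x}.

Definition omega1_le : rel omega1 := fun a b => set_nat_le (val a) (val b).

Fact omega1_lexx : reflexive omega1_le.
Proof. by move=> a; exact: set_nat_lexx. Qed.

Fact omega1_le_anti : antisymmetric omega1_le.
Proof. by move=> a b ab; apply: val_inj; exact: set_nat_le_anti. Qed.

Fact omega1_le_trans : transitive omega1_le.
Proof. by move=> b a c; exact: set_nat_le_trans. Qed.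

Fact omega1_le_total : total omega1_le.
Proof. by move=> a b; exact: set_nat_le_total. Qed.

Fact omega1_display : Order.disp_t. Proof. exact: Order.Disp tt tt. Qed.

HB.instance Definition _ := Order.Le_isPOrder.Build omega1_display omega1
  omega1_lexx omega1_le_anti omega1_le_trans.
HB.instance Definition _ :=
  Order.POrder_isTotal.Build omega1_display omega1 omega1_le_total.

Lemma omega1_least (A : set omega1) : A !=set0 ->
  exists2 a, A a & forall b, A b -> (a <= b).
Proof.
case=> a0 Aa0; have [|_ [a Aa <-] mina] := @set_nat_least (val @` A).
  by exists (val a0), a0.
by exists a => // b Ab; apply: mina; exists b.
Qed.

Lemma omega1_seg_countable (a : omega1) : countable [set b : omega1 | b <= a].
Proof.
have /asboolP/countable_injP[g ginj] := valP a.
apply/countable_injP; exists (g \o val) => b c /set_mem ba /set_mem ca /= gbc.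
by apply/val_inj/ginj; rewrite ?inE.
Qed.

Lemma omega1_uncountable : ~ countable [set: omega1].
Proof.
move=> o1c; pose S := [set x : set nat | in_omega1 x].
have Sc : countable S.
  apply: (@sub_countable _ _ _ (val @` [set: omega1])).
    by apply: subset_card_le => x Sx; exists (Sub x Sx).
  exact: sub_countable (card_image_le _ _) o1c.
have [TS|nTS] := pselect ([set: set nat] `<=` S).
  by apply: set_nat_uncountable; apply: sub_countable Sc; exact: subset_card_le.
have [|m nSm minm] := @set_nat_least (~` S).
  apply: contrapT => nS; apply: nTS => x _; apply: contrapT => nSx.
  by apply: nS; exists x.
apply/nSm/asboolP; apply: (@sub_countable _ _ _ (S `|` [set m])).
  apply: subset_card_le => y /= ym; have [Sy|/minm my] := pselect (S y).
    by left.
  by right; apply: set_nat_le_anti; rewrite ym my.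
rewrite -bigcup2E; apply: bigcup_countable => // -[|[|n]] _ //=.
Qed.

Lemma omega1_wf : well_founded (fun a b : omega1 => a < b).
Proof.
move=> a; apply: contrapT => nacc.
have [|b nb minb] := @omega1_least [set b | ~ Acc (fun a b => a < b) b].
  by exists a.
apply: nb; constructor => c cb; apply: contrapT => /minb.
by rewrite leNgt cb.
Qed.

Lemma omega1_bounded (S : set omega1) : countable S -> has_ubound S.
Proof.
move=> Sc; apply: contrapT => nS; apply: omega1_uncountable.
apply: (@sub_countable _ _ _ (\bigcup_(a in S) [set b | b <= a])).
  apply: subset_card_le => b _; apply: contrapT => nb; apply: nS.
  exists b => a Sa; case: (leP a b) => // /ltW ba; exfalso; apply: nb.
  by exists a.
by apply: bigcup_countable => // a _; exact: omega1_seg_countable.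
Qed.

Lemma omega1_supremums (S : set omega1) : countable S -> supremums S !=set0.
Proof.
by move=> /omega1_bounded/omega1_least[a Sa mina]; exists a; split.
Qed.

Lemma omega1_nonempty : [set: omega1] !=set0.
Proof.
apply: contrapT => n0; apply: omega1_uncountable.
suff -> : [set: omega1] = set0 by exact: countable0.
by apply: contrapT => /eqP/set0P.
Qed.

Definition ozero : omega1 := sval (cid2 (omega1_least omega1_nonempty)).

Lemma ozero_le (a : omega1) : ozero <= a.
Proof. by rewrite /ozero; case: cid2 => b _ /= minb; exact: minb. Qed.

Definition osup (S : set omega1) : omega1 := supremum ozero S.

Definition osucc (a : omega1) : omega1 := infimum ozero [set b | a < b].

Definition oone : omega1 := osucc ozero.

Definition olim (a : omega1) : Prop :=
  ozero < a /\ forall b, b < a -> osucc b < a.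

Definition oeven (a : omega1) : Prop :=
  exists l n, (l = ozero \/ olim l) /\ a = iter n.*2 osucc l.

(** [a + b = sup ({a} U {(a + b') + 1 : b' < b})]; see [oaddE]. *)
Definition oadd (a : omega1) : omega1 -> omega1 :=
  Fix omega1_wf (fun=> omega1) (fun b add_a =>
    osup ([set a] `|`
          [set c | exists b' (ltb : b' < b), c = osucc (add_a b' ltb)])).

(** [a . n = a + ... + a] ([n] summands). *)
Definition omuln (a : omega1) (n : nat) : omega1 :=
  iter n (fun c => oadd c a) ozero.

(** [omega ^ b = sup ({1} U {omega ^ b' . n : b' < b, n < omega})]: this gives
    [omega ^ 0 = 1], [omega ^ (b + 1) = sup_n (omega ^ b . n)], and the supremum
    of the earlier powers at limits; see [oexpE], [oexp0], [oexpS], [oexp_lim]. *)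
Definition oexp : omega1 -> omega1 :=
  Fix omega1_wf (fun=> omega1) (fun b pow =>
    osup ([set oone] `|`
          [set c | exists b' (ltb : b' < b) n, c = omuln (pow b' ltb) n])).

Lemma oaddE a b : oadd a b =
  osup ([set a] `|` [set osucc (oadd a b') | b' in [set b' | b' < b]]).
Proof.
rewrite {1}/oadd Fix_eq -?/(oadd a); last first.
  move=> x f g fg; congr (osup (_ `|` _)); apply/seteqP.
  by split=> c [b' [ltb ->]]; exists b', ltb; rewrite fg.
congr (osup (_ `|` _)); apply/seteqP; split=> c.
  by case=> b' [ltb ->]; exists b'.
by case=> b' ltb <-; exists b', ltb.
Qed.

Lemma oexpE b : oexp b =
  osup ([set oone] `|`
        \bigcup_(b' in [set b' | b' < b]) range (omuln (oexp b'))).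
Proof.
rewrite {1}/oexp Fix_eq -?/oexp; last first.
  move=> x f g fg; congr (osup (_ `|` _)); apply/seteqP.
  by split=> c [b' [ltb [n ->]]]; exists b', ltb, n; rewrite fg.
congr (osup (_ `|` _)); apply/seteqP; split=> c.
  by case=> b' [ltb [n ->]]; exists b' => //; exists n.
by case=> b' ltb [n _ <-]; exists b', ltb, n.
Qed.

Lemma osup_ub (S : set omega1) a : countable S -> S a -> a <= osup S.
Proof. by move=> /omega1_supremums S0 Sa; exact: ge_supremum_Nmem. Qed.

Lemma osup_le (S : set omega1) b : (forall a, S a -> a <= b) -> osup S <= b.
Proof.
move=> Sb; rewrite /osup /supremum; case: ifPn => [_|_]; first exact: ozero_le.
by case: xgetP => [a _ [_]|_]; [exact|exact: ozero_le].
Qed.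

Lemma osuccP a : a < osucc a /\ forall b, a < b -> osucc a <= b.
Proof.
have [b ab] : [set b | a < b] !=set0.
  apply: contrapT => n; apply: omega1_uncountable.
  apply: sub_countable (omega1_seg_countable a); apply: subset_card_le => b _.
  by rewrite /= leNgt; apply/negP => ab; apply: n; exists b.
have [c ac minc] := @omega1_least [set b | a < b] (ex_intro _ b ab).
suff -> : osucc a = c by [].
rewrite /osucc /infimum ifF; last by apply/negbTE/set0P; exists b.
have cinf : infimums [set b | a < b] c by split=> // d; exact.
by case: xgetP => [d _ dinf|/(_ c)//]; exact: is_subset1_infimums cinf.
Qed.

Lemma ltoS a : a < osucc a. Proof. by have [] := osuccP a. Qed.

Lemma ltoSE a b : (a < osucc b) = (a <= b).
Proof.
apply/idP/idP => [aSb|/le_lt_trans]; last by apply; exact: ltoS.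
by rewrite leNgt; apply/negP => /(osuccP b).2; rewrite leNgt aSb.
Qed.

Lemma oadd0o a : oadd ozero a = a.
Proof.
elim/(well_founded_ind omega1_wf): a => a IH; rewrite oaddE; apply: le_anti.
apply/andP; split.
  apply: osup_le => c [-> |[b /= ba <-]]; first exact: ozero_le.
  by rewrite IH //; exact: (osuccP b).2.
rewrite leNgt; apply/negP; set s := osup _ => sa.
suff : osucc s <= s by rewrite leNgt ltoS.
apply: osup_ub; last by right; exists s => //; rewrite IH.
rewrite -bigcup2E; apply: bigcup_countable => // -[|[|n]] _ //=.
apply: sub_countable (card_image_le _ _) _.
apply: sub_countable (omega1_seg_countable a).
by apply: subset_card_le => b /= /ltW.
Qed.

Lemma oexp_countable b : countable ([set oone] `|`
        \bigcup_(b' in [set b' | b' < b]) range (omuln (oexp b'))).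
Proof.
rewrite -bigcup2E; apply: bigcup_countable => // -[|[|n]] _ //=.
apply: bigcup_countable => [|b' _].
  apply: sub_countable (omega1_seg_countable b).
  by apply: subset_card_le => c /= /ltW.
exact: sub_countable (card_image_le _ _) _.
Qed.

Lemma oexp_ge1 b : oone <= oexp b.
Proof. by rewrite oexpE; apply: osup_ub (@oexp_countable b) _; left. Qed.

Lemma omuln_oexp_le b b' n : b' < b -> omuln (oexp b') n <= oexp b.
Proof.
move=> ltb; rewrite [leRHS]oexpE; apply: osup_ub (@oexp_countable b) _.
by right; exists b' => //; exists n.
Qed.

Lemma oexp0 : oexp ozero = oone.
Proof.
apply: le_anti; rewrite oexp_ge1 andbT oexpE; apply: osup_le => c [-> //|].
by case=> b /=; rewrite ltNge ozero_le.
Qed.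

Lemma oexpS b : oexp (osucc b) = osup (range (omuln (oexp b))).
Proof.
have rc : countable (range (omuln (oexp b))).
  exact: sub_countable (card_image_le _ _) _.
have exp_le : oexp b <= osup (range (omuln (oexp b))).
  by apply: osup_ub rc _; exists 1%N; rewrite //= oadd0o.
apply: le_anti; apply/andP; split.
  rewrite oexpE; apply: osup_le => c [->|[b' /= ltb [n _ <-]]].
    exact: le_trans (oexp_ge1 b) exp_le.
  move: ltb; rewrite ltoSE le_eqVlt => /predU1P[->|/omuln_oexp_le-/(_ n)].
    by apply: osup_ub rc _; exists n.
  by move=> /le_trans; apply.
by apply: osup_le => _ [n _ <-]; apply: omuln_oexp_le; exact: ltoS.
Qed.

Lemma oexp_lim b : olim b -> oexp b = osup (oexp @` [set b' | b' < b]).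
Proof.
move=> [b0 bS]; have ic : countable (oexp @` [set b' | b' < b]).
  apply: sub_countable (card_image_le _ _) _.
  apply: sub_countable (omega1_seg_countable b).
  by apply: subset_card_le => c /= /ltW.
apply: le_anti; apply/andP; split.
  rewrite oexpE; apply: osup_le => c [->|[b' /= ltb [n _ <-]]].
    by apply: osup_ub ic _; exists ozero; rewrite //= oexp0.
  apply: le_trans (omuln_oexp_le n (ltoS b')) _.
  by apply: osup_ub ic _; exists (osucc b') => //=; exact: bS.
apply: osup_le => _ [b' /= ltb <-].
by have := omuln_oexp_le 1 ltb; rewrite /= oadd0o.
Qed.

(** Ranks range over the countable ordinals and a top element [omega1_rank],
    which stands for omega_1, so that suprema of sets of ranks always exist and a
    minimum over an empty set of candidates is omega_1, never a junk ordinal. *)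

Definition rank := option omega1.

HB.instance Definition _ := Choice.copy rank (option omega1).

Definition ord_rank (a : omega1) : rank := Some a.

Definition omega1_rank : rank := None.

Definition rank_le : rel rank := fun r s =>
  match r, s with
  | _, None => true
  | None, Some _ => false
  | Some a, Some b => a <= b
  end.

Fact rank_lexx : reflexive rank_le.
Proof. by case=> //= a. Qed.

Fact rank_le_anti : antisymmetric rank_le.
Proof. by case=> [a|] [b|] //= /le_anti ->. Qed.

Fact rank_le_trans : transitive rank_le.
Proof. by case=> [b|] [a|] [c|] //=; exact: le_trans. Qed.

Fact rank_le_total : total rank_le.
Proof. by case=> [a|] [b|] //=; exact: le_total. Qed.

Fact rank_display : Order.disp_t. Proof. exact: Order.Disp tt tt. Qed.

HB.instance Definition _ := Order.Le_isPOrder.Build rank_display rank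
  rank_lexx rank_le_anti rank_le_trans.
HB.instance Definition _ :=
  Order.POrder_isTotal.Build rank_display rank rank_le_total.

Lemma rank_least (S : set rank) : S !=set0 ->
  exists2 r, S r & forall s, S s -> r <= s.
Proof.
case=> r Sr; have [[a Sa]|nS] := pselect ([set a | S (Some a)] !=set0).
  have [b Sb minb] := @omega1_least [set a | S (Some a)] (ex_intro _ a Sa).
  by exists (Some b) => // -[c|//] Sc; exact: (minb c).
exists r => // -[c|_]; last by case: r {Sr}.
by move=> Sc; exfalso; apply: nS; exists c.
Qed.

Lemma rank_supremums (S : set rank) : supremums S !=set0.
Proof.
have [|r Sr minr] := @rank_least (ubound S); first by exists omega1_rank; case.
by exists r.
Qed.

Definition rank_sup (S : set rank) : rank := supremum (ord_rank ozero) S.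

(** Attained whenever [S] is nonempty ([rank_minP]). *)
Definition rank_min (S : set rank) : rank := infimum omega1_rank S.

Lemma rank_minP (S : set rank) : S !=set0 ->
  S (rank_min S) /\ forall s, S s -> rank_min S <= s.
Proof.
move=> S0; have [r Sr minr] := rank_least S0.
suff -> : rank_min S = r by [].
rewrite /rank_min /infimum ifF; last by apply/negbTE/set0P; exists r.
have rinf : infimums S r by split=> // s; exact.
by case: xgetP => [s _ sinf|/(_ r)//]; exact: is_subset1_infimums rinf.
Qed.

Definition rank_lesssim (r s : rank) : Prop :=
  forall eta : omega1, oone <= eta ->
    s <= ord_rank (oexp eta) -> r <= ord_rank (oexp eta).

Definition rank_approx (r s : rank) : Prop :=
  rank_lesssim r s /\ rank_lesssim s r.

Definition polish_space (R : realType) (X : topologicalType) : Prop :=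
  (exists2 D : set X, countable D & dense D) /\
  exists d : X -> X -> R,
    [/\ [/\ forall x y, 0 <= d x y,
            forall x y, d x y = 0 <-> x = y,
            forall x y, d x y = d y x
          & forall x y z, d x z <= d x y + d y z],
        forall U : set X, open U <->
          forall x, U x -> exists2 e : R, 0 < e & [set y | d x y < e] `<=` U
      & forall u : nat -> X,
          (forall e : R, 0 < e -> exists N, forall m n,
             (N <= m)%N -> (N <= n)%N -> d (u m) (u n) < e) ->
          exists x, forall e : R, 0 < e -> exists N, forall n,
            (N <= n)%N -> d (u n) x < e].

(** [Sigma0 xi] is the additive class of level [xi >= 1]; the members of the
    countable unions are written as sets with additive complement. *)
Inductive Sigma0 (X : topologicalType) : omega1 -> set X -> Prop :=
| Sigma0_open (U : set X) : open U -> Sigma0 oone U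
| Sigma0_bigcup (xi : omega1) (zeta : nat -> omega1) (A : nat -> set X) :
    (forall n, oone <= zeta n /\ zeta n < xi) ->
    (forall n, Sigma0 (zeta n) (~` A n)) ->
    Sigma0 xi (\bigcup_n A n).

Definition Pi0 (X : topologicalType) (xi : omega1) (A : set X) : Prop :=
  Sigma0 xi (~` A).

Definition Delta0 (X : topologicalType) (xi : omega1) (A : set X) : Prop :=
  Sigma0 xi A /\ Pi0 xi A.

Inductive baire_class (R : realType) (X : topologicalType) :
  omega1 -> (X -> R) -> Prop :=
| baire_class_continuous (f : X -> R) : continuous f -> baire_class ozero f
| baire_class_lim (xi : omega1) (zeta : nat -> omega1) (g : nat -> X -> R)
    (f : X -> R) :
    (forall n, zeta n < xi) -> (forall n, baire_class (zeta n) (g n)) ->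
    (forall x, g n x @[n --> \oo] --> f x) ->
    baire_class xi f.

(** The sequence [(F_eta)_(eta < lam)] is a total function on the countable
    ordinals, equal to the empty set from [lam] on. In particular [lam] is
    nonzero when [X] is nonempty. *)
Definition continuous_decreasing (X : Type) (lam : omega1)
    (F : omega1 -> set X) : Prop :=
  [/\ forall eta theta, eta <= theta -> F theta `<=` F eta,
      F ozero = setT,
      forall eta, olim eta -> eta < lam ->
        F eta = \bigcap_(theta in [set theta | theta < eta]) F theta,
      olim lam -> \bigcap_(eta in [set eta | eta < lam]) F eta = set0
    & forall eta, lam <= eta -> F eta = set0].

Definition transfinite_difference (X : Type) (lam : omega1)
    (F : omega1 -> set X) : set X :=
  \bigcup_(eta in [set eta | eta < lam /\ oeven eta]) (F eta `\` F (osucc eta)).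

Definition alpha_sets (X : topologicalType) (xi : omega1) (A B : set X) : rank :=
  rank_min [set ord_rank lam | lam in [set lam | exists F : omega1 -> set X,
    [/\ continuous_decreasing lam F,
        forall eta, eta < lam -> Pi0 xi (F eta),
        A `<=` transfinite_difference lam F
      & transfinite_difference lam F `<=` ~` B]]].

Definition alpha (R : realType) (X : topologicalType) (xi : omega1)
    (f : X -> R) : rank :=
  rank_sup [set r | exists p q : rat, p < q /\
    r = alpha_sets xi [set x | f x <= ratr p] [set x | ratr q <= f x]].

Definition delta_fin (R : realType) (X : topologicalType) (xi : omega1)
    (f : X -> R) : rank :=
  rank_sup [set r | exists2 e : R, 0 < e &
    r = rank_min [set s | exists (N : nat) (H : 'I_N.+1 -> set X)
                                 (c : 'I_N.+1 -> R),
      [/\ [/\ trivIset setT H, \bigcup_n H n = setT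
            & forall n, Delta0 (osucc xi) (H n)],
          forall x, `|f x - \sum_(n < N.+1) c n * \1_(H n) x| <= e
        & s = \big[Order.max/ord_rank ozero]_(n < N.+1)
                alpha_sets xi (H n) (~` H n)]]].

(* Main.v *)
(** A continuous decreasing sequence of length [lam] is the same thing as a
    function [r : X -> lam] all of whose sets [{r >= g}] are [Pi0 xi], and its
    transfinite difference is the set where [r] is even. If [A] and [B] are the
    even sets of [r, s : X -> omega ^ e], any Boolean combination of them is the
    even set of [2 (r # s) + 0 or 1], where [#] is the natural sum: [#] is
    strictly increasing in each argument, so the last bit is free to choose
    without losing monotonicity, and [omega ^ e] is closed under [#]. Hence the
    sets of rank at most [omega ^ e] form an algebra (for [e >= 1]).

    If step functions on partitions into such sets approximate [f], then
    [{f <= p}] and [{f >= q}] are separated by a union of pieces. Conversely, if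
    sets [S_n] of this algebra separate [{f <= p_n}] from [{f >= p_(n+1)}] for a
    fine grid [p_0 < ... < p_N] spanning the range of [f], the differences
    [S_n \ (S_0 u ... u S_(n-1))] form a partition on which [f] is nearly
    constant. *)

Require Import Defs.
From mathcomp Require Import all_boot all_order all_algebra.
From mathcomp Require Import all_classical all_reals all_analysis.
From mathcomp Require Import lra.

Import Order.TTheory GRing.Theory Num.Theory.
Import numFieldNormedType.Exports.

Local Open Scope order_scope.
Local Open Scope classical_set_scope.

(** * Ordinal arithmetic *)

Lemma osucc_leE (a b : omega1) : (osucc a <= b) = (a < b).
Proof.
by apply/idP/idP => [|/(osuccP a).2 //]; apply: lt_le_trans; exact: ltoS.
Qed.

Lemma omega1_initial_countable (P : set omega1) (b : omega1) :
  (forall a, P a -> a <= b) -> countable P.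
Proof.
move=> Pb; apply: sub_countable (omega1_seg_countable b).
by apply: subset_card_le => a /Pb.
Qed.

Lemma countable_setU (T : Type) (A B : set T) :
  countable A -> countable B -> countable (A `|` B).
Proof.
move=> cA cB; rewrite -bigcup2E; apply: bigcup_countable => // -[|[|n]] _ //=.
Qed.

Lemma oadd_countable (a b : omega1) :
  countable ([set a] `|` [set osucc (oadd a b') | b' in [set b' | b' < b]]).
Proof.
apply: countable_setU => //; apply: sub_countable (card_image_le _ _) _.
by apply: (omega1_initial_countable _ b) => c /ltW.
Qed.

Lemma oadd_ltl (a b c : omega1) : b < c -> oadd a b < oadd a c.
Proof.
move=> bc; rewrite -osucc_leE [leRHS]oaddE.
by apply: osup_ub (oadd_countable a c) _; right; exists b.
Qed.

Lemma oadd_lel (a b c : omega1) : b <= c -> oadd a b <= oadd a c.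
Proof. by rewrite le_eqVlt => /predU1P[->//|/oadd_ltl/ltW]. Qed.

Lemma oadd_lt2l (a b c : omega1) : (oadd a b < oadd a c) = (b < c).
Proof.
by apply/idP/idP => [|/oadd_ltl //]; rewrite !ltNge; apply: contra => /oadd_lel.
Qed.

Lemma oadd_geL (a b : omega1) : a <= oadd a b.
Proof. by rewrite [leRHS]oaddE; apply: osup_ub (oadd_countable a b) _; left. Qed.

Lemma oadd_geR (a b : omega1) : b <= oadd a b.
Proof.
elim/(well_founded_ind omega1_wf): b => b IH; rewrite leNgt; apply/negP => ltb.
by have := IH _ ltb; rewrite leNgt oadd_lt2l ltb.
Qed.

(** The least [d] with [c <= oadd a d] works: by minimality every term of the supremum in [oaddE] is
    at most [c]. *)
Lemma oadd_sub (a c : omega1) : a <= c -> exists d, c = oadd a d.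
Proof.
move=> ac; have [|d cd mind] := @omega1_least [set d | c <= oadd a d].
  by exists c; exact: oadd_geR.
exists d; apply: le_anti; rewrite cd /= oaddE.
apply: osup_le => _ [->//|[b bd <-]]; rewrite osucc_leE ltNge.
by apply/negP => /mind; rewrite leNgt bd.
Qed.

Lemma omuln_le (w : omega1) m n : (m <= n)%N -> omuln w m <= omuln w n.
Proof.
move/subnK <-; elim: (n - m)%N => //= k /le_trans; apply.
exact: oadd_geL.
Qed.

Lemma omuln_div (w c : omega1) n : c < omuln w n ->
  exists i d, d < w /\ c = oadd (omuln w i) d.
Proof.
elim: n => [|n IH] /=; first by rewrite ltNge ozero_le.
have [/IH //|/oadd_sub[d ->]] := ltP c (omuln w n).
by rewrite oadd_lt2l; exists n, d.
Qed.

Lemma omuln_digit_lt (w : omega1) i j d : d < w -> (i < j)%N ->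
  oadd (omuln w i) d < omuln w j.
Proof.
by move=> dw /(omuln_le w); apply: lt_le_trans; rewrite [ltRHS]/= oadd_lt2l.
Qed.

Lemma lt_oexp (c e : omega1) : c < oexp e ->
  c = ozero \/ exists b n, b < e /\ c < omuln (oexp b) n.
Proof.
move=> ce; apply: contrapT => /not_orP[c0 nc]; move: ce; rewrite ltNge.
case/negP; rewrite oexpE; apply: osup_le => _ [->|[b /= be [n _ <-]]].
  by rewrite /oone osucc_leE lt_neqAle ozero_le andbT eq_sym; apply/eqP.
by rewrite leNgt; apply/negP => cb; apply: nc; exists b, n.
Qed.

Lemma oexp_gt0 (e : omega1) : ozero < oexp e.
Proof. by rewrite -osucc_leE; exact: oexp_ge1. Qed.

(** If [c] lies below [omuln (oexp b) n], then [osucc c] lies below the next multiple. The exponent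
    0 must be excluded because [oexp ozero] is 1. *)
Lemma oexp_osucc_lt (c e : omega1) : oone <= e -> c < oexp e -> osucc c < oexp e.
Proof.
rewrite osucc_leE => e0 /lt_oexp cE.
have [b [n [be cb]]] : exists b n, b < e /\ c < omuln (oexp b) n.
  case: cE => [->|//]; exists ozero, 1%N; split=> //.
  by rewrite /= oadd0o oexp_gt0.
apply: lt_le_trans (omuln_oexp_le n.+1 be).
apply: (@le_lt_trans _ _ (omuln (oexp b) n)); first by rewrite osucc_leE.
exact: le_lt_trans (oadd_geL _ _) (oadd_ltl _ _ _ (oexp_gt0 b)).
Qed.

(** * The natural sum *)
Definition pair_lt (u v : omega1 * omega1) : Prop :=
  (u.1 < v.1 /\ u.2 <= v.2) \/ (u.1 <= v.1 /\ u.2 < v.2).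

(** Nested induction: the outer hypothesis handles a drop of the first coordinate, the inner one a
    drop of the second alone. *)
Lemma pair_lt_wf : well_founded pair_lt.
Proof.
suff W a : forall b, Acc pair_lt (a, b) by case=> a b; exact: W.
elim/(well_founded_ind omega1_wf): a => a IHa b.
elim/(well_founded_ind omega1_wf): b => b IHb.
constructor=> -[a' b'] [[/= aa _]|[/=]]; first exact: IHa.
by rewrite le_eqVlt => /predU1P[-> /IHb|/IHa].
Qed.

(* The least function on pairs that strictly increases along [pair_lt]: this is
   the Hessenberg sum, with no appeal to Cantor normal forms. *)
Definition onat_sum : omega1 * omega1 -> omega1 :=
  Fix pair_lt_wf (fun=> omega1) (fun v sum =>
    osup [set c | exists u (ltu : pair_lt u v), c = osucc (sum u ltu)]).

Lemma onat_sumE v :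
  onat_sum v = osup [set osucc (onat_sum u) | u in [set u | pair_lt u v]].
Proof.
rewrite {1}/onat_sum Fix_eq -?/onat_sum.
  congr osup; apply/seteqP; split=> c.
    by case=> u [ltu ->]; exists u.
  by case=> u ltu <-; exists u, ltu.
move=> x f g fg; congr osup; apply/seteqP.
by split=> c [u [ltu ->]]; exists u, ltu; rewrite fg.
Qed.

Lemma onat_sum_lt u v : pair_lt u v -> onat_sum u < onat_sum v.
Proof.
move=> uv; rewrite -osucc_leE [leRHS]onat_sumE; apply: osup_ub; last by exists u.
(* The supremum bounds its terms only if they are countably many; the pairs below [v] lie in a
   product of two countable segments. *)
apply: sub_countable (card_image_le _ _) _.
apply: (@sub_countable _ _ _ ([set a | a <= v.1] `*` [set b | b <= v.2])).
  by apply: subset_card_le => w [[/ltW ? ?]|[? /ltW ?]]; split.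
by apply: countableX; exact: omega1_seg_countable.
Qed.

Lemma onat_sum_le v c : (forall u, pair_lt u v -> onat_sum u < c) ->
  onat_sum v <= c.
Proof.
by move=> H; rewrite onat_sumE; apply: osup_le => _ [u /H uc <-]; rewrite osucc_leE.
Qed.

(** Induction on the pair. Below it, either the sum of the quotients by [w] drops, and the
    remainders cannot make up for this since their natural sum stays below [w], or both quotients
    persist and the pair of remainders drops. *)
Lemma onat_sum_digits (w : omega1) :
  (forall a b, a < w -> b < w -> onat_sum (a, b) < w) ->
  forall i j a b, a < w -> b < w ->
  onat_sum (oadd (omuln w i) a, oadd (omuln w j) b) <=
  oadd (omuln w (i + j)) (onat_sum (a, b)).
Proof.
move=> closed i j a b aw bw.
(* Naming the pair lets the induction run over all quotients and remainders at once. *)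
move: {2}(oadd (omuln w i) a, _) (erefl (oadd (omuln w i) a, oadd (omuln w j) b)) => v.
elim/(well_founded_ind pair_lt_wf): v i j a b aw bw => v IH i j a b aw bw vE.
apply: onat_sum_le => -[a1 b1] uv.
(* Ordinals up to [oadd (omuln w i') a'] are compared with it digit by digit, quotient first. *)
have dig i' a' c : a' < w -> c <= oadd (omuln w i') a' ->
  exists k d, [/\ d < w, c = oadd (omuln w k) d & (k < i')%N \/ k = i' /\ d <= a'].
  move=> a'w ca; have [|k [d [dw cE]]] := @omuln_div w c i'.+1.
    by apply: le_lt_trans ca _; rewrite [ltRHS]/= oadd_lt2l.
  exists k, d; split=> //; have [ltk|ltk|kE] := ltngtP k i'; first by left.
    have := lt_le_trans (omuln_digit_lt _ _ _ _ a'w ltk) (oadd_geL _ d).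
    by rewrite -cE ltNge ca.
  by right; split=> //; move: ca; rewrite cE kE leNgt oadd_lt2l -leNgt.
have [k [d [dw a1E ki]]] : exists k d,
    [/\ d < w, a1 = oadd (omuln w k) d & (k < i)%N \/ k = i /\ d <= a].
  by apply: dig => //; case: uv => /= -[] // /ltW.
have [l [e [ew b1E lj]]] : exists k d,
    [/\ d < w, b1 = oadd (omuln w k) d & (k < j)%N \/ k = j /\ d <= b].
  by apply: dig => //; case: uv => /= -[] // _ /ltW.
rewrite {}a1E {}b1E in uv *.
apply: le_lt_trans (IH _ _ k l d e dw ew erefl) _; first by rewrite -vE.
have [kl|kl] := ltnP (k + l) (i + j).
  by apply: lt_le_trans (oadd_geL _ _); apply: omuln_digit_lt => //; exact: closed.
have [ki' da] : k = i /\ d <= a.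
  case: ki => // ki; suff : (k + l < i + j)%N by rewrite ltnNge kl.
  by rewrite -addSn leq_add //; case: lj => [/ltnW//|[->]].
have [lj' eb] : l = j /\ e <= b.
  case: lj => // lj; suff : (k + l < i + j)%N by rewrite ltnNge kl.
  by rewrite ki' ltn_add2l.
rewrite ki' lj' oadd_lt2l; apply: onat_sum_lt.
move: uv; rewrite ki' lj' /pair_lt /= !oadd_lt2l => -[[? _]|[_ ?]].
  by left.
by right.
Qed.

Lemma onat_sum_oexp (e a b : omega1) :
  a < oexp e -> b < oexp e -> onat_sum (a, b) < oexp e.
Proof.
elim/(well_founded_ind omega1_wf): e a b => e IH a b ae be.
(* Both arguments are put below multiples of the same power: the larger of two exponents serves,
   since its power absorbs every finite multiple of the smaller one. *)
have [[a0 b0]|[z [n [m [ze az bz]]]]] : (a = ozero /\ b = ozero) \/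
    exists z n m, [/\ z < e, a < omuln (oexp z) n & b < omuln (oexp z) m].
- case: (lt_oexp _ _ ae) => [a0|[za [n [zae az]]]];
    case: (lt_oexp _ _ be) => [b0|[zb [m [zbe bz]]]].
  + by left.
  + right; exists zb, m, m; split=> //; rewrite a0.
    exact: le_lt_trans (ozero_le b) bz.
  + right; exists za, n, n; split=> //; rewrite b0.
    exact: le_lt_trans (ozero_le a) az.
  + have pow1 z : omuln (oexp z) 1 = oexp z by rewrite /= oadd0o.
    right; have [ab|ba|abE] := ltgtP za zb.
    * exists zb, 1%N, m; split=> //; rewrite pow1.
      exact: lt_le_trans az (omuln_oexp_le n ab).
    * exists za, n, 1%N; split=> //; rewrite pow1.
      exact: lt_le_trans bz (omuln_oexp_le m ba).
    * by exists za, n, m; rewrite {3}abE.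
- apply: le_lt_trans (oexp_gt0 e); apply: onat_sum_le => -[a' b'].
  by rewrite a0 b0 /pair_lt /= !ltNge !ozero_le => -[[]|[]].
have [i [a' [a'z ->]]] := omuln_div _ _ _ az.
have [j [b' [b'z ->]]] := omuln_div _ _ _ bz.
apply: le_lt_trans (onat_sum_digits _ (IH z ze) _ _ _ _ a'z b'z) _.
(* One extra copy of [oexp z] makes room for the natural sum of the remainders. *)
apply: lt_le_trans (omuln_oexp_le (i + j).+1 ze).
by rewrite [ltRHS]/= oadd_lt2l; exact: IH.
Qed.

(** * Parity *)
Definition limit_part (l : omega1) : Prop := l = ozero \/ olim l.

Lemma limit_part_osucc (l b : omega1) : limit_part l -> b < l -> osucc b < l.
Proof.
by case=> [->|[_]]; [rewrite ltNge ozero_le|apply].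
Qed.

Lemma limit_part_iter (l b : omega1) n :
  limit_part l -> b < l -> iter n osucc b < l.
Proof. by move=> ll bl; elim: n => //= n; exact: limit_part_osucc. Qed.

Lemma omega1_cases (a : omega1) : limit_part a \/ exists b, a = osucc b.
Proof.
have [|na] := pselect (limit_part a); first by left.
right; apply: contrapT => nS; apply: na.
have [->|a0] := eqVneq a ozero; first by left.
right; split=> [|b ba]; first by rewrite lt_neqAle eq_sym a0 ozero_le.
rewrite lt_neqAle osucc_leE ba andbT; apply/eqP => bE.
by apply: nS; exists b.
Qed.

Lemma omega1_limit_split (a : omega1) :
  exists ln : omega1 * nat, limit_part ln.1 /\ a = iter ln.2 osucc ln.1.
Proof.
elim/(well_founded_ind omega1_wf): a => a IH.
have [la|[b aE]] := omega1_cases a; first by exists (a, 0%N).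
have [|[l n] [/= ll bE]] := IH b; first by rewrite aE ltoS.
by exists (l, n.+1); rewrite /= -bE.
Qed.

Lemma iter_osucc_ge (l : omega1) n : l <= iter n osucc l.
Proof. by elim: n => //= n /le_trans; apply; exact/ltW/ltoS. Qed.

Lemma iter_osucc_lt (l : omega1) m n :
  (m < n)%N -> iter m osucc l < iter n osucc l.
Proof.
move/subnK <-; rewrite iterD; apply: lt_le_trans (iter_osucc_ge _ _).
exact: ltoS.
Qed.

(** Finitely many successors cannot lead from below a limit part up to it. This uniqueness makes
    parity well defined. *)
Lemma limit_split_inj (k l : omega1) m n : limit_part k -> limit_part l ->
  iter m osucc k = iter n osucc l -> k = l /\ m = n.
Proof.
move=> lk ll E; have [kl|lk'|klE] := ltgtP k l.
- have := limit_part_iter _ _ m ll kl.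
  by rewrite E ltNge iter_osucc_ge.
- have := limit_part_iter _ _ n lk lk'.
  by rewrite -E ltNge iter_osucc_ge.
- split=> //; rewrite klE in E.
  have [/(iter_osucc_lt l)|/(iter_osucc_lt l)|//] := ltngtP m n.
    by rewrite E ltxx.
  by rewrite E ltxx.
Qed.

Lemma oeven_iter (l : omega1) n : limit_part l ->
  oeven (iter n osucc l) <-> ~~ odd n.
Proof.
move=> ll; split=> [[k [m [lk /(limit_split_inj _ _ _ _ ll lk)[_ ->]]]]|nn].
  by rewrite odd_double.
by exists l, n./2; rewrite even_halfK.
Qed.

(** This is the ordinal product 2 . a, with 2 on the left: it keeps the limit part and doubles the
    finite part. *)
Definition odouble (a : omega1) : omega1 :=
  let ln := sval (cid (omega1_limit_split a)) in iter ln.2.*2 osucc ln.1.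

Lemma odouble_even (a : omega1) : oeven (odouble a).
Proof.
rewrite /odouble; case: cid => -[l n] [/= ll _].
by apply/oeven_iter => //; rewrite odd_double.
Qed.

Lemma odoubleS_odd (a : omega1) : ~ oeven (osucc (odouble a)).
Proof.
rewrite /odouble; case: cid => -[l n] [/= ll _].
by move/(oeven_iter _ n.*2.+1 ll); rewrite /= odd_double.
Qed.

(** The gap of two between consecutive values leaves room for a free parity bit. *)
Lemma odouble_lt (a b : omega1) : a < b -> osucc (odouble a) < odouble b.
Proof.
rewrite /odouble; case: cid => -[l n] [/= ll ->]; case: cid => -[k m] [/= lk ->].
have [lk'|kl|<-] := ltgtP l k.
- move=> _; apply: lt_le_trans (iter_osucc_ge _ _).
  exact: (limit_part_iter _ _ n.*2.+1).
- rewrite ltNge => /negP[]; apply: le_trans (iter_osucc_ge l n).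
  exact/ltW/limit_part_iter.
- move=> nm; apply: (iter_osucc_lt l n.*2.+1).
  rewrite ltn_Sdouble ltnNge; apply/negP; rewrite leq_eqVlt => /predU1P[mE|].
    by rewrite mE ltxx in nm.
  by move/(iter_osucc_lt l)/(lt_trans nm); rewrite ltxx.
Qed.

Lemma odouble_oexp (e a : omega1) : oone <= e -> a < oexp e -> odouble a < oexp e.
Proof.
rewrite /odouble; case: cid => -[l n] [/= ll ->] e1 le.
have {}le : l < oexp e := le_lt_trans (iter_osucc_ge _ _) le.
by elim: n.*2 => //= m; exact: oexp_osucc_lt.
Qed.

(** * The additive classes *)

(** This property makes [Sigma0] increase from level one, which has only the open sets, to the
    levels built from unions. *)
Definition open_Fsigma (X : topologicalType) : Prop :=
  forall U : set X, open U -> exists C : nat -> set X,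
    (forall n, open (~` C n)) /\ U = \bigcup_n C n.

Lemma polish_open_Fsigma (R : realType) (X : topologicalType) :
  polish_space R X -> open_Fsigma X.
Proof.
move=> [_ [d [[d0 dxy dC dD] openP _]]] U /openP oU.
(* [C n] consists of the points at distance at least 1/(n+1) from the complement of [U]. *)
pose C n := [set x | forall y, (d x y < n.+1%:R^-1)%R -> U y].
exists C; split=> [n|].
  apply/openP => x nCx.
  have [y [xy nUy]] : exists y, (d x y < n.+1%:R^-1)%R /\ ~ U y.
    apply: contrapT => H; apply: nCx => y xy; apply: contrapT => nUy.
    by apply: H; exists y.
  exists (n.+1%:R^-1 - d x y)%R; first by rewrite subr_gt0.
  move=> z /= xz Cz; apply: nUy; apply: Cz.
  by apply: le_lt_trans (dD z x y) _; rewrite dC -ltrBrDr.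
apply/seteqP; split=> [x /oU[e e0 He]|x [n _ Cx]]; last first.
  by apply: Cx; have /dxy -> : x = x by []; rewrite invr_gt0 ltr0n.
have [n ne] := ltr_add_invr e0.
exists n => // y /lt_trans xy; apply: He; apply: xy.
by rewrite add0r in ne.
Qed.

Lemma Sigma0_inv {X : topologicalType} {xi : omega1} {A : set X} :
  Sigma0 xi A -> (xi = oone /\ open A) \/
  (exists (zeta : nat -> omega1) (B : nat -> set X),
    [/\ forall n, oone <= zeta n /\ zeta n < xi,
        forall n, Sigma0 (zeta n) (~` B n) & A = \bigcup_n B n]).
Proof.
by case=> [U oU|xi' zeta B zetaP BP]; [left|right; exists zeta, B].
Qed.

Lemma Sigma0_ge1 {X : topologicalType} {xi : omega1} {A : set X} :
  Sigma0 xi A -> oone <= xi.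
Proof.
case=> [//|{}xi zeta B zetaP _].
by have [z1 /ltW] := zetaP 0%N; exact: le_trans.
Qed.

Lemma Sigma0_1_open {X : topologicalType} {A : set X} : Sigma0 oone A -> open A.
Proof.
case/Sigma0_inv=> [[]//|[zeta [B [zetaP _ _]]]].
by have [] := zetaP 0%N; rewrite leNgt => /negP.
Qed.

Lemma Sigma0_unions {X : topologicalType} {xi : omega1} {A : set X} :
  xi <> oone -> Sigma0 xi A ->
  exists (zeta : nat -> omega1) (B : nat -> set X),
    [/\ forall n, oone <= zeta n /\ zeta n < xi,
        forall n, Sigma0 (zeta n) (~` B n) & A = \bigcup_n B n].
Proof. by move=> xi1 /Sigma0_inv[[]|]. Qed.

Lemma Pi0_Sigma0 {X : topologicalType} {zeta xi : omega1} {A : set X} :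
  zeta < xi -> Pi0 zeta A -> Sigma0 xi A.
Proof.
move=> zx PA; rewrite -(bigcup_const (P := [set: nat]) A); last by exists 0%N.
by apply: (@Sigma0_bigcup _ _ (fun=> zeta)) => // _; rewrite (Sigma0_ge1 PA).
Qed.

Lemma Sigma0_le {X : topologicalType} {zeta xi : omega1} {A : set X} :
  open_Fsigma X -> zeta <= xi -> Sigma0 zeta A -> Sigma0 xi A.
Proof.
move=> XF; rewrite le_eqVlt => /predU1P[->//|zx].
case/Sigma0_inv=> [[zE /XF[C [oC ->]]]|[z [B [zP BP ->]]]].
  rewrite zE in zx; apply: (@Sigma0_bigcup _ _ (fun=> oone)) => // n.
  exact/Sigma0_open/oC.
apply: (@Sigma0_bigcup _ _ z) => // n.
by have [z1 zz] := zP n; rewrite z1 (lt_trans zz zx).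
Qed.

Lemma Sigma0_setT {X : topologicalType} {xi : omega1} :
  open_Fsigma X -> oone <= xi -> Sigma0 xi [set: X].
Proof. by move=> XF /(Sigma0_le XF); apply; apply: Sigma0_open; exact: openT. Qed.

Lemma Sigma0_set0 {X : topologicalType} {xi : omega1} :
  open_Fsigma X -> oone <= xi -> Sigma0 xi (@set0 X).
Proof. by move=> XF /(Sigma0_le XF); apply; apply: Sigma0_open; exact: open0. Qed.

Lemma Sigma0_bigcup_nat {X : topologicalType} {xi : omega1} {A : nat -> set X} :
  (forall n, Sigma0 xi (A n)) -> Sigma0 xi (\bigcup_n A n).
Proof.
move=> SA; have [xiE|/eqP xi1] := eqVneq xi oone.
  rewrite xiE in SA *; apply: Sigma0_open; apply: bigcup_open => n _.
  exact: Sigma0_1_open.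
have /choice[zB zBP] : forall n, exists zB : (nat -> omega1) * (nat -> set X),
    [/\ forall m, oone <= zB.1 m /\ zB.1 m < xi,
        forall m, Sigma0 (zB.1 m) (~` zB.2 m) & A n = \bigcup_m zB.2 m].
  by move=> n; have [z [B H]] := Sigma0_unions xi1 (SA n); exists (z, B).
(* A double union is flattened along a coding of pairs; a number coding no pair decodes to (0, 0)
   and only repeats a piece. *)
pose u k : nat * nat := odflt (0, 0)%N (unpickle k).
have -> : \bigcup_n A n = \bigcup_k (zB (u k).1).2 (u k).2.
  apply/seteqP; split=> [x [n _]|x [k _ Bx]].
    have [_ _ ->] := zBP n; case=> m _ Bx.
    by exists (pickle (n, m)) => //; rewrite /u pickleK.
  by exists (u k).1 => //; have [_ _ ->] := zBP (u k).1; exists (u k).2.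
by apply: (@Sigma0_bigcup _ _ (fun k => (zB (u k).1).1 (u k).2)) => k;
  have [] := zBP (u k).1.
Qed.

Lemma Sigma0_countable {X : topologicalType} {xi : omega1} {I : choiceType}
    {D : set I} {A : I -> set X} : open_Fsigma X -> oone <= xi -> countable D ->
  (forall i, D i -> Sigma0 xi (A i)) -> Sigma0 xi (\bigcup_(i in D) A i).
Proof.
move=> XF xi1 /countable_injP[g ginj] SA.
(* The indices are grouped by their code, so that each group is a singleton or empty. *)
have -> : \bigcup_(i in D) A i = \bigcup_n \bigcup_(i in D `&` [set i | g i = n]) A i.
  apply/seteqP; split=> [x [i Di Ax]|x [n _ [i [Di _] Ax]]]; last by exists i.
  by exists (g i) => //; exists i.
apply: Sigma0_bigcup_nat => n.
have [[i [Di gi]]|nD] := pselect ((D `&` [set i | g i = n]) !=set0).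
  suff -> : D `&` [set i | g i = n] = [set i] by rewrite bigcup_set1; exact: SA.
  apply/seteqP; split=> [j [Dj /= gj]|j ->//].
  by apply: ginj; rewrite ?inE // gj gi.
have -> : D `&` [set i | g i = n] = set0.
  by apply: contrapT => /eqP/set0P.
by rewrite bigcup_set0; exact: Sigma0_set0.
Qed.

Lemma Sigma0_setU {X : topologicalType} {xi : omega1} {A B : set X} :
  Sigma0 xi A -> Sigma0 xi B -> Sigma0 xi (A `|` B).
Proof.
move=> SA SB; have -> : A `|` B = \bigcup_n (if n is 0%N then A else B).
  apply/seteqP; split=> [x [Ax|Bx]|x [[|n] _ Hx]]; [by exists 0%N|by exists 1%N|..].
    by left.
  by right.
by apply: Sigma0_bigcup_nat => -[|n].
Qed.

Lemma Sigma0_setI {X : topologicalType} {xi : omega1} {A B : set X} :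
  open_Fsigma X -> Sigma0 xi A -> Sigma0 xi B -> Sigma0 xi (A `&` B).
Proof.
move=> XF SA SB; have xi1 := Sigma0_ge1 SA.
have [xiE|/eqP xi_n1] := eqVneq xi oone.
  rewrite xiE in SA SB *.
  by apply/Sigma0_open/openI; exact: Sigma0_1_open.
have [zA [A' [zAP A'P ->]]] := Sigma0_unions xi_n1 SA.
have [zB [B' [zBP B'P ->]]] := Sigma0_unions xi_n1 SB.
(* After distributing, each piece is multiplicative of the larger of two levels, which is still
   below [xi]. *)
have -> : (\bigcup_n A' n) `&` (\bigcup_n B' n) =
    \bigcup_(k in [set: nat * nat]) (A' k.1 `&` B' k.2).
  apply/seteqP; split=> [x [[n _ An] [m _ Bm]]|x [k _ [Ak Bk]]].
    by exists (n, m).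
  by split; [exists k.1|exists k.2].
apply: Sigma0_countable => // [|[n m] _ /=]; first exact: countableP.
have [_ zAn] := zAP n; have [_ zBm] := zBP m.
apply: (@Pi0_Sigma0 _ (Order.max (zA n) (zB m))); first by rewrite gt_max zAn zBm.
rewrite /Pi0 setCI; apply: Sigma0_setU.
  by apply: Sigma0_le (A'P n) => //; rewrite le_max lexx.
by apply: Sigma0_le (B'P m) => //; rewrite le_max lexx orbT.
Qed.

Lemma Pi0_setU {X : topologicalType} {xi : omega1} {A B : set X} :
  open_Fsigma X -> Pi0 xi A -> Pi0 xi B -> Pi0 xi (A `|` B).
Proof. by move=> XF PA PB; rewrite /Pi0 setCU; exact: Sigma0_setI. Qed.

Lemma Pi0_setI {X : topologicalType} {xi : omega1} {A B : set X} :
  Pi0 xi A -> Pi0 xi B -> Pi0 xi (A `&` B).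
Proof. by move=> PA PB; rewrite /Pi0 setCI; exact: Sigma0_setU. Qed.

Lemma Pi0_set0 {X : topologicalType} {xi : omega1} :
  open_Fsigma X -> oone <= xi -> Pi0 xi (@set0 X).
Proof. by move=> XF xi1; rewrite /Pi0 setC0; exact: Sigma0_setT. Qed.

Lemma Pi0_setD {X : topologicalType} {xi : omega1} {A B : set X} :
  open_Fsigma X -> Pi0 xi A -> Pi0 xi B -> Sigma0 (osucc xi) (A `\` B).
Proof.
move=> XF PA PB; rewrite setDE; apply: Sigma0_setI => //.
  exact: Pi0_Sigma0 (ltoS xi) PA.
exact: Sigma0_le XF (ltW (ltoS xi)) PB.
Qed.

(** * Rank functions *)

Definition difference_rank (X : topologicalType) (xi lam : omega1) (A : set X)
    (r : X -> omega1) : Prop :=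
  [/\ forall x, r x < lam,
      forall g, Pi0 xi [set x | g <= r x]
    & forall x, A x <-> oeven (r x)].

Definition difference_of (X : topologicalType) (xi lam : omega1) (A : set X) : Prop :=
  exists r, difference_rank X xi lam A r.

Lemma transfinite_difference_rank (X : topologicalType) (xi lam : omega1)
    (F : omega1 -> set X) : open_Fsigma X -> oone <= xi ->
  continuous_decreasing lam F -> (forall eta, eta < lam -> Pi0 xi (F eta)) ->
  difference_of X xi lam (transfinite_difference lam F).
Proof.
move=> XF xi1 [Fdec F0 Flim lamlim Flam] PF.
(* [r x] is the last index whose set contains [x]. It exists because the least [t] with [x] outside
   [F t] is neither 0 nor a limit: continuity excludes limits below [lam], and the empty
   intersection excludes [lam] itself. *)
have /choice[r rP] : forall x, exists g, g < lam /\ forall eta, F eta x <-> eta <= g.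
  move=> x; have [|t nFt mint] := @omega1_least [set t | ~ F t x].
    by exists lam => /=; rewrite Flam.
  have before eta : eta < t -> F eta x.
    by move=> lt; apply: contrapT => /mint; rewrite leNgt lt.
  have tlam : t <= lam by apply: mint; rewrite /= Flam.
  have [[t0|lt]|[g tE]] := omega1_cases t.
  - by exfalso; apply: nFt; rewrite t0 F0.
  - exfalso; move: tlam; rewrite le_eqVlt => /predU1P[tE|tlam].
      rewrite tE in lt before.
      suff : (\bigcap_(eta in [set eta | eta < lam]) F eta) x by rewrite lamlim.
      by move=> eta; exact: before.
    by apply: nFt; rewrite Flim // => eta; exact: before.
  - exists g; split=> [|eta]; first by rewrite -osucc_leE -tE.
    split=> [Fx|]; last by rewrite -ltoSE -tE; exact: before.
    rewrite -ltoSE -tE ltNge; apply/negP => te.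
    by apply: nFt; exact: Fdec Fx.
exists r; split=> [x|g|x].
- by have [] := rP x.
- have -> : [set x | g <= r x] = F g.
    by apply/seteqP; split=> x /(rP x).2.
  have [/PF//|/Flam ->] := ltP g lam.
  exact: Pi0_set0.
- have [rl Fr] := rP x; split=> [[eta [_ ev] [/Fr er nFr]]|ev].
    suff -> : r x = eta by [].
    by apply: le_anti; rewrite er andbT leNgt -osucc_leE; apply/negP => /Fr.
  exists (r x) => //; split; first exact/Fr.
  by move=> /Fr; rewrite osucc_leE ltxx.
Qed.

(** The sets [g <= r x] form the sequence. It is continuous because a rank below a limit has its
    successor below that limit. *)
Lemma difference_rank_sequence {X : topologicalType} {xi lam : omega1}
    {A : set X} : difference_of X xi lam A ->
  exists F : omega1 -> set X,
    [/\ continuous_decreasing lam F, forall eta, eta < lam -> Pi0 xi (F eta)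
      & transfinite_difference lam F = A].
Proof.
move=> [r [rlam rP rA]]; exists (fun g => [set x | g <= r x]); split=> //.
- split=> [g h gh x /=|||[_ lamS]|g lg].
  + exact: le_trans.
  + by apply/seteqP; split=> // x _ /=; exact: ozero_le.
  + move=> g [g0 gS] _; apply/seteqP; split=> [x /= gr h /= hg|x H /=].
      exact: le_trans (ltW hg) gr.
    rewrite leNgt; apply/negP => rg.
    by have := H _ (gS _ rg); rewrite /= osucc_leE ltxx.
  + apply/seteqP; split=> // x H.
    by have := H _ (lamS _ (rlam x)); rewrite /= osucc_leE ltxx.
  + apply/seteqP; split=> // x /=.
    by rewrite leNgt (lt_le_trans (rlam x) lg).
- apply/seteqP; split=> [x [g [/= _ ev] [/= gr /negP]]|x Ax].
    rewrite osucc_leE -leNgt => rg; apply/rA.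
    by have -> : r x = g by apply: le_anti; rewrite gr rg.
  exists (r x); first by split=> //; exact/rA.
  by split=> /=; rewrite ?osucc_leE ?ltxx.
Qed.

Lemma difference_of_le {X : topologicalType} {xi lam lam' : omega1} {A : set X} :
  lam <= lam' -> difference_of X xi lam A -> difference_of X xi lam' A.
Proof.
move=> ll [r [rl rP rA]]; exists r; split=> // x.
exact: lt_le_trans (rl x) ll.
Qed.

Lemma alpha_sets_leP (X : topologicalType) (xi lam : omega1) (A B : set X) :
  open_Fsigma X -> oone <= xi ->
  alpha_sets xi A B <= ord_rank lam <->
  exists S, [/\ difference_of X xi lam S, A `<=` S & S `<=` ~` B].
Proof.
move=> XF xi1; rewrite /alpha_sets; set L := [set ord_rank _ | _ in _].
split=> [Lle|[S [/difference_rank_sequence[F [Fc PF FS]] AS SB]]].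
  have [L0|nL] := pselect (L !=set0); last first.
    (* Without candidates the minimum is [omega1_rank], which is not below [ord_rank lam]. *)
    move: Lle; have -> : L = set0 by apply: contrapT => /eqP/set0P.
    by rewrite /rank_min /infimum eqxx.
  have [[l [F [Fc PF AS SB]] lE] _] := rank_minP L0.
  exists (transfinite_difference l F); split=> //.
  apply: (@difference_of_le _ _ l); first by move: Lle; rewrite -lE.
  exact: transfinite_difference_rank.
have Llam : L (ord_rank lam) by exists lam => //; exists F; rewrite FS.
exact: (rank_minP (ex_intro _ _ Llam)).2.
Qed.

Lemma alpha_setsC_leP (X : topologicalType) (xi lam : omega1) (A : set X) :
  open_Fsigma X -> oone <= xi ->
  alpha_sets xi A (~` A) <= ord_rank lam <-> difference_of X xi lam A.
Proof.
move=> XF xi1; split=> [/(alpha_sets_leP _ _ _ _ _ XF xi1)[S [dS AS]]|dA].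
  by rewrite setCK => SA; have -> : A = S by apply/seteqP; split.
by apply/(alpha_sets_leP _ _ _ _ _ XF xi1); exists A; rewrite setCK; split.
Qed.

Lemma difference_of_Delta0 (X : topologicalType) (xi lam : omega1) (A : set X) :
  open_Fsigma X -> oone <= xi -> difference_of X xi lam A ->
  Delta0 (osucc xi) A.
Proof.
move=> XF xi1 [r [rl rP rA]].
(* Every set of ranks pulls back to a countable union of level sets of [r], each a difference of two
   [Pi0 xi] sets. *)
have SP (P : set omega1) : Sigma0 (osucc xi) [set x | P (r x)].
  have -> : [set x | P (r x)] = \bigcup_(g in P `&` [set g | g < lam])
      ([set x | g <= r x] `\` [set x | osucc g <= r x]).
    apply/seteqP; split=> [x Px|x [g [Pg _] [/= gr]]].
      by exists (r x); split=> //=; rewrite osucc_leE ltxx.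
    move=> /negP; rewrite osucc_leE -leNgt => rg.
    by have -> : r x = g by apply: le_anti; rewrite gr rg.
  apply: Sigma0_countable => //; first exact: le_trans xi1 (ltW (ltoS xi)).
    by apply: (omega1_initial_countable _ lam) => g [_ /ltW].
  by move=> g _; exact: Pi0_setD.
have -> : A = [set x | oeven (r x)] by apply/seteqP; split=> x /rA.
by split; [exact: (SP oeven)|exact: (SP (~` oeven))].
Qed.

(** * Boolean combinations *)

(* An up-set of pairs is a finite union of quadrants; the induction on [c]
   peels them off from the right. *)
Lemma Pi0_quadrants (X : topologicalType) (xi c : omega1) (r s : X -> omega1)
    (U : set (omega1 * omega1)) : open_Fsigma X -> oone <= xi ->
  (forall g, Pi0 xi [set x | g <= r x]) ->
  (forall g, Pi0 xi [set x | g <= s x]) ->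
  Pi0 xi [set x | exists u, [/\ U u, u.1 < c, u.1 <= r x & u.2 <= s x]].
Proof.
move=> XF xi1 rP sP; elim/(well_founded_ind omega1_wf): c => c IH.
have [[u0 [Uu0 u0c]]|nU] := pselect (exists u, U u /\ u.1 < c); last first.
  rewrite (_ : [set _ | _] = set0); first exact: Pi0_set0.
  by apply/seteqP; split=> // x [u [Uu uc _ _]]; apply: nU; exists u.
(* With [b] least, the quadrant of [(a, b)] absorbs every pair whose first coordinate is at least
   [a]; the others fall under the induction hypothesis at [a]. *)
have [|b [a [Uab ac]] minb] := @omega1_least [set b | exists a, U (a, b) /\ a < c].
  by exists u0.2, u0.1; case: u0 Uu0 u0c.
rewrite (_ : [set _ | _] = ([set x | a <= r x] `&` [set x | b <= s x]) `|`
   [set x | exists u, [/\ U u, u.1 < a, u.1 <= r x & u.2 <= s x]]).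
  by apply: Pi0_setU => //; [exact: Pi0_setI|exact: IH].
apply/seteqP; split=> x.
  move=> [[u v] [/= Uu uc ur vs]]; have [ua|au] := ltP u a.
    by right; exists (u, v).
  left; split=> /=; first exact: le_trans ur.
  by apply: le_trans vs; apply: minb; exists u.
case=> [[/= ar bs]|[u [Uu ua ur us]]]; first by exists (a, b).
by exists u; split=> //; exact: lt_trans ac.
Qed.

Lemma difference_of_comb (X : topologicalType) (xi e : omega1) (A B : set X)
    (C : Prop -> Prop -> Prop) : open_Fsigma X -> oone <= xi -> oone <= e ->
  difference_of X xi (oexp e) A -> difference_of X xi (oexp e) B ->
  difference_of X xi (oexp e) [set x | C (A x) (B x)].
Proof.
move=> XF xi1 e1 [r [re rP rA]] [s [se sP sB]].
pose comb (u : omega1 * omega1) : Prop := C (oeven u.1) (oeven u.2).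
pose phi (u : omega1 * omega1) :=
  if `[< comb u >] then odouble (onat_sum u) else osucc (odouble (onat_sum u)).
have phiS u : phi u <= osucc (odouble (onat_sum u)).
  by rewrite /phi; case: ifP => // _; exact/ltW/ltoS.
have phi_ge u : odouble (onat_sum u) <= phi u.
  by rewrite /phi; case: ifP => // _; exact/ltW/ltoS.
have phi_homo u v : u.1 <= v.1 -> u.2 <= v.2 -> phi u <= phi v.
  move=> uv1 uv2; have [->//|nuv] := eqVneq u v.
  suff /onat_sum_lt/odouble_lt/ltW uv : pair_lt u v.
    exact: le_trans (phiS u) (le_trans uv (phi_ge v)).
  case: u v uv1 uv2 nuv => u1 u2 [v1 v2] /= uv1 uv2 nuv.
  rewrite /pair_lt /= uv1 uv2; have [uvE|uv1'] := eqVneq u1 v1.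
    right; split=> //; rewrite lt_neqAle uv2 andbT.
    by apply: contraNneq nuv => ->; rewrite uvE.
  by left; rewrite lt_neqAle uv1' uv1.
exists (fun x => phi (r x, s x)); split=> [x|g|x].
- apply: le_lt_trans (phiS _) _.
  by apply: oexp_osucc_lt => //; apply: odouble_oexp => //; exact: onat_sum_oexp.
(* As [phi] is monotone, the superlevel set is the union of the quadrants at pairs where [phi] is at
   least [g]. *)
- rewrite (_ : [set _ | _] = [set x | exists u, [/\ g <= phi u, u.1 < oexp e,
      u.1 <= r x & u.2 <= s x]]).
    exact: (Pi0_quadrants _ _ _ _ _ (fun u => g <= phi u)).
  apply/seteqP; split=> x /= => [gx|[u [gu _ ur us]]].
    by exists (r x, s x); split=> /=.
  by apply: le_trans gu _; apply: phi_homo.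
- rewrite /= (_ : A x = oeven (r x)); last exact/propext/rA.
  rewrite (_ : B x = oeven (s x)); last exact/propext/sB.
  rewrite /phi; case: asboolP => // Cx; split=> //.
    by move=> _; exact: odouble_even.
  by move=> /odoubleS_odd.
Qed.

(** A constant odd rank works, and it lies below [oexp e] since [e] is at least 1. *)
Lemma difference_of_set0 (X : topologicalType) (xi e : omega1) :
  open_Fsigma X -> oone <= xi -> oone <= e -> difference_of X xi (oexp e) set0.
Proof.
move=> XF xi1 e1; exists (fun=> osucc (odouble ozero)); split=> [x|g|x].
- by apply: oexp_osucc_lt => //; apply: odouble_oexp => //; exact: oexp_gt0.
- have [ge|ge] := leP g (osucc (odouble ozero)).
    rewrite /Pi0 (_ : ~` _ = set0); first exact: Sigma0_set0.
    by apply/seteqP; split=> // x [].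
  rewrite (_ : [set _ | _] = set0); first exact: Pi0_set0.
  by apply/seteqP; split=> // x /=; rewrite leNgt ge.
- by split=> // /odoubleS_odd.
Qed.

Lemma difference_of_bigsetU (X : topologicalType) (xi e : omega1) (I : Type)
    (s : seq I) (P : pred I) (A : I -> set X) :
  open_Fsigma X -> oone <= xi -> oone <= e ->
  (forall i, difference_of X xi (oexp e) (A i)) ->
  difference_of X xi (oexp e) (\big[setU/set0]_(i <- s | P i) A i).
Proof.
move=> XF xi1 e1 dA; apply: big_ind => // [|B C dB dC].
  exact: difference_of_set0.
exact: (difference_of_comb _ _ _ _ _ or).
Qed.

(** * The two inequalities *)

Lemma rank_sup_ub (S : set rank) (r : rank) : S r -> r <= rank_sup S.
Proof. exact/ge_supremum_Nmem/rank_supremums. Qed.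

Lemma rank_sup_le (S : set rank) (s : rank) :
  (forall r, S r -> r <= s) -> rank_sup S <= s.
Proof.
move=> Ss; rewrite /rank_sup /supremum; case: ifPn => [_|_].
  by case: s Ss => // a _; exact: ozero_le.
case: xgetP => [r _ [_]|/(_ _)]; first exact.
by case: (rank_supremums S) => r Sr /(_ r).
Qed.

Lemma rank_min_attained (S : set rank) (a : omega1) :
  rank_min S <= ord_rank a -> exists2 r, S r & r <= ord_rank a.
Proof.
have [S0 Sa|nS] := pselect (S !=set0).
  by exists (rank_min S) => //; exact: (rank_minP S0).1.
have -> : S = set0 by apply: contrapT => /eqP/set0P.
by rewrite /rank_min /infimum eqxx.
Qed.

Lemma step_functionE (R : realType) (X : Type) (N : nat)
    (H : 'I_N.+1 -> set X) (c : 'I_N.+1 -> R) (i : 'I_N.+1) (x : X) :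
  trivIset setT H -> H i x -> (\sum_(n < N.+1) c n * \1_(H n) x = c i)%R.
Proof.
move=> tH Hx; rewrite (bigD1 i) //= big1 => [|j ji].
  by rewrite addr0 indicE mem_set // mulr1.
rewrite indicE memNset ?mulr0 // => Hjx.
by move/eqP: ji; apply; apply: tH => //; exists x.
Qed.

Lemma alpha_lesssim_delta_fin (R : realType) (X : topologicalType)
    (xi : omega1) (f : X -> R) : open_Fsigma X -> oone <= xi ->
  rank_lesssim (alpha xi f) (delta_fin xi f).
Proof.
move=> XF xi1 e e1 dle; apply: rank_sup_le => _ [p [q [pq ->]]].
have pqR : (ratr p < ratr q :> R)%R by rewrite ltr_rat.
(* With a third of the gap, a piece meeting the set [f <= p] has its constant at most [p + eps], and
   a piece with such a constant has [f <= p + 2 eps < q]. *)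
pose eps : R := ((ratr q - ratr p) / 3)%R.
have eps0 : (0 < eps)%R by rewrite /eps; lra.
have := fun r Dr => le_trans (rank_sup_ub _ r Dr) dle.
move=> /(_ _ (ex_intro2 _ _ eps eps0 erefl))/rank_min_attained.
case=> _ [N [H [c [[tH cH _] fH ->]]]] max_le.
apply/(alpha_sets_leP _ _ _ _ _ XF xi1).
exists (\big[setU/set0]_(n | (c n <= ratr p + eps)%R) H n); split.
- apply: difference_of_bigsetU => // n.
  apply/(alpha_setsC_leP _ _ _ _ XF xi1).
  by apply: le_trans max_le; exact: le_bigmax.
- move=> x /= fp; have [n _ Hx] : (\bigcup_n H n) x by rewrite cH.
  rewrite -bigcup_pred; exists n => //=.
  have := fH x; rewrite (step_functionE _ _ _ _ _ _ _ tH Hx) ler_norml => /andP[].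
  by move=> lo _; suff : (c n <= ratr p + eps)%R by []; lra.
- move=> x; rewrite -bigcup_pred => -[n]; rewrite /= => cn' Hx qf.
  have cn : (c n <= ratr p + eps)%R by [].
  have := fH x; rewrite (step_functionE _ _ _ _ _ _ _ tH Hx) ler_norml => /andP[].
  by move: cn qf; rewrite /eps /=; lra.
Qed.

Lemma delta_fin_lesssim_alpha (R : realType) (X : topologicalType)
    (xi : omega1) (f : X -> R) : open_Fsigma X -> oone <= xi -> bounded_fun f ->
  rank_lesssim (delta_fin xi f) (alpha xi f).
Proof.
move=> XF xi1 [M [_ fM]] e e1 ale; apply: rank_sup_le => _ [eps eps0 ->].
have {fM} [K fK] : exists K : nat, forall x, (- K%:R <= f x <= K%:R)%R.
  exists (Num.truncn M).+1 => x; rewrite -ler_norml.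
  exact: fM (truncnS_gt M) x I.
have [k keps] := ltr_add_invr eps0; rewrite add0r in keps.
(* The grid starts at [-K] and has mesh 1/(k+1), smaller than [eps]; it is rational because [alpha]
   ranges over rational pairs. *)
pose p (n : nat) : rat := (n%:R / k.+1%:R - K%:R)%R.
have pE n : (ratr (p n) = n%:R / k.+1%:R - K%:R :> R)%R.
  by rewrite rmorphB fmorph_div /= !rmorph_nat.
have pS n : (ratr (p n.+1) = ratr (p n) + k.+1%:R^-1 :> R)%R.
  by rewrite !pE -natr1 mulrDl mul1r addrAC.
have /choice[S SP] : forall n, exists S, [/\ difference_of X xi (oexp e) S,
    [set x | (f x <= ratr (p n))%R] `<=` S &
    S `<=` ~` [set x | (ratr (p n.+1) <= f x)%R]].
  move=> n; apply/(alpha_sets_leP _ _ _ _ _ XF xi1); apply: le_trans ale.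
  apply: rank_sup_ub; exists (p n), (p n.+1); split=> //.
  by rewrite -(ltr_rat R) pS ltrDl invr_gt0 ltr0n.
pose N := (K.*2 * k.+1)%N.
have pN : (ratr (p N) = K%:R :> R)%R.
  rewrite pE /N natrM mulfK ?pnatr_eq0 // -addnn natrD; lra.
pose H (n : 'I_N.+1) := seqDU S n.
have dH n : difference_of X xi (oexp e) (H n).
  apply: (difference_of_comb _ _ _ _ _ (fun P Q => P /\ ~ Q)) => //.
    by have [] := SP n.
  by apply: difference_of_bigsetU => // i; have [] := SP i.
have tH : trivIset setT H.
  move=> i j _ _ Hij; apply: val_inj.
  by apply: (@trivIset_seqDU _ S).
have cH : \bigcup_n H n = setT.
  apply/seteqP; split=> // x _.
  (* The last set [S N] is the whole space, since [p N = K] bounds [f]. *)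
  have : (\bigcup_(i < N.+1) seqDU S i) x.
    rewrite bigcup_mkord -bigsetU_seqDU -bigcup_mkord; exists N => //=.
    by have [_ + _] := SP N; apply; rewrite /= pN; have /andP[] := fK x.
  by case=> i /= iN Hx; exists (Ordinal iN).
apply: (@le_trans _ _ (\big[Order.max/ord_rank ozero]_(n < N.+1)
    alpha_sets xi (H n) (~` H n))).
  set L := [set s | _]; suff Lm : L (\big[Order.max/ord_rank ozero]_(n < N.+1)
    alpha_sets xi (H n) (~` H n)) by exact: (rank_minP (ex_intro _ _ Lm)).2.
  (* On the piece [H n] the value [p n] is within one mesh of [f]: membership in [S n] gives the
     upper bound, absence from the preceding set the lower one. *)
  exists N, H, (fun n => ratr (p n)); split=> [|x|//].
    by split=> // n; exact: difference_of_Delta0 (dH n).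
  have [n _ Hx] : (\bigcup_n H n) x by rewrite cH.
  rewrite (step_functionE _ _ _ _ _ _ _ tH Hx).
  have kpos : (0 < k.+1%:R^-1 :> R)%R by rewrite invr_gt0 ltr0n.
  have [Snx nSx] := Hx.
  have fup : (f x < ratr (p n) + k.+1%:R^-1)%R.
    have [_ _ /(_ x Snx)/negP] := SP n.
    by rewrite -ltNge pS.
  suff flow : (ratr (p n) - k.+1%:R^-1 <= f x)%R.
    move: fup flow keps; move: (k.+1%:R^-1)%R => t fup flow keps.
    by rewrite ler_norml; apply/andP; split; lra.
  (* The first piece has no preceding set; there [p 0 = -K] gives the lower bound. *)
  case nE : (nat_of_ord n) => [|m].
    rewrite pE mul0r sub0r; have /andP[+ _] := fK x; apply: le_trans.
    by rewrite gerBl ltW.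
  rewrite pS addrK leNgt; apply/negP => fpm; apply: nSx.
  rewrite -bigcup_mkord; exists m => /=; first by rewrite nE.
  by have [_ + _] := SP m; apply; exact: ltW.
apply: bigmax_le => [|n _]; first exact: ozero_le.
exact/(alpha_setsC_leP _ _ _ _ XF xi1).
Qed.

Theorem theorem4p21 (R : realType) (X : topologicalType) (xi : omega1) :
  polish_space R X -> ~ countable [set: X]%classic -> (oone <= xi)%O ->
  forall f : X -> R, bounded_fun f -> baire_class xi f ->
    rank_approx (delta_fin xi f) (alpha xi f).
Proof.
move=> /polish_open_Fsigma XF _ xi1 f bf _; split.
  exact: delta_fin_lesssim_alpha.
exact: alpha_lesssim_delta_fin.
Qed.
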